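(* Let $\mathbf K$ be $\mathbf H$ or $\mathbf O$. If a function $f$ on a domain $U$ in $\mathbf K$ (an open connected subset of $\mathbf K$) is pseudoconformal, then its image $V:=f(U)$ is also a domain in $\mathbf K$.
   Context: $\mathbf K$ is the quaternion skew field $\mathbf H$ ($r=2$) or the octonion algebra $\mathbf O$ ($r=3$); $\tilde z=z^*$ is the conjugate, $|z|^2=z\tilde z$, $\mathrm{Re}(z)=(z+\tilde z)/2$. Functions of $z$ are represented by phrases (finite or convergent infinite sums of bracketed words in $z$, $\tilde z$ and constants of $\mathbf K$); $\partial f/\partial z$ and $\partial f/\partial\tilde z$ are the partial (super)derivatives, $\mathbf R$-linear operators $h\mapsto(\partial f/\partial z).h$, $h\mapsto(\partial f/\partial\tilde z).h$ whose sum is the Fréchet derivative. A differentiable $f:U\to\mathbf K$ is pseudoconformal at $\xi\in U$ if (1) $\partial f(z)/\partial\tilde z=0$ at $z=\xi$; (2) writing $f'(\xi)=(\partial f/\partial z)|_{z=\xi}$, $\mathrm{Re}\{[f'(\xi).h_1][f'(\xi).h_2]^*\}|h_1||h_2|=|f'(\xi).h_1||f'(\xi).h_2|\,\mathrm{Re}(h_1\tilde h_2)$ for all $h_1,h_2\in\mathbf K$; (3) $f'(\xi)\neq0$; where nonproper rotations of the underlying space $\mathbf R^{2^r}$ associated with $f'$ are excluded. $f$ is pseudoconformal on $U$ if it is so at each point of $U$. *)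

(* Defs.v *)
From HB Require Import structures.
From mathcomp Require Import all_boot all_order all_algebra.
From mathcomp Require Import all_classical all_reals all_analysis.

Set Implicit Arguments.
Unset Strict Implicit.
Unset Printing Implicit Defensive.

Import Order.TTheory GRing.Theory Num.Theory.
Import numFieldNormedType.Exports.

Local Open Scope classical_set_scope.
Local Open Scope ring_scope.

(* The doubling n + n, rather than 2 ^ r itself, makes the two halves of a
   Cayley-Dickson number available through lsubmx and rsubmx without a cast. *)
Fixpoint cd_dim (r : nat) : nat :=
  if r is r'.+1 then (cd_dim r' + cd_dim r')%N else 1%N.

Lemma cd_dimE (r : nat) : cd_dim r = (2 ^ r)%N.
Proof. by elim: r => //= r ->; rewrite expnS mul2n addnn. Qed.

(* Cayley-Dickson numbers A_r on the real space of dimension 2 ^ r: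
   A_0 = R, A_1 = C, A_2 = H (quaternions), A_3 = O (octonions).
   The norm provided by the library on row vectors is the sup norm; it is used
   only for its topology and for Frechet differentiability, which do not depend
   on the choice of a norm.  The modulus |z| is cd_abs below. *)
Notation cd R r := ('rV[R]_(cd_dim r)).

Section CayleyDickson.
Variable R : realType.

Fixpoint cd_conj {r : nat} : cd R r -> cd R r :=
  match r return cd R r -> cd R r with
  | 0 => fun z => z
  | r'.+1 => fun z => row_mx (cd_conj (lsubmx z)) (- rsubmx z)
  end.

(* (a, b) (c, d) = (a c - d~ b, d a + b c~) *)
Fixpoint cd_mul {r : nat} : cd R r -> cd R r -> cd R r :=
  match r return cd R r -> cd R r -> cd R r with
  | 0 => fun x y => \row_i (x 0 i * y 0 i)
  | r'.+1 => fun x y =>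
      let a := lsubmx x in let b := rsubmx x in
      let c := lsubmx y in let d := rsubmx y in
      row_mx (cd_mul a c - cd_mul (cd_conj d) b)
             (cd_mul d a + cd_mul b (cd_conj c))
  end.

Fixpoint cd_one {r : nat} : cd R r :=
  match r return cd R r with
  | 0 => const_mx 1
  | r'.+1 => row_mx cd_one 0
  end.

(* The coordinate along 1, which is the real number (z + z~) / 2: see cd_reE *)
Fixpoint cd_re {r : nat} : cd R r -> R :=
  match r return cd R r -> R with
  | 0 => fun z => z 0 0
  | r'.+1 => fun z => cd_re (lsubmx z)
  end.

(* z z~ = |z|^2: see cd_absE *)
Definition cd_abs {r : nat} (z : cd R r) : R :=
  Num.sqrt (cd_re (cd_mul z (cd_conj z))).

End CayleyDickson.

Lemma cd_conjK (R : realType) (r : nat) (z : cd R r) :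
  cd_conj (cd_conj z) = z.
Proof.
elim: r z => [//|r IH] z /=.
by rewrite row_mxKl row_mxKr IH opprK hsubmxK.
Qed.

Lemma cd_reE (R : realType) (r : nat) (z : cd R r) :
  2^-1 *: (z + cd_conj z) = cd_re z *: cd_one R.
Proof.
elim: r z => [|r IH] z /=.
  apply/rowP => i; rewrite !mxE (ord1 i) mulr1.
  by rewrite mulrC mulrDl -splitr.
rewrite -[z in z + _]hsubmxK add_row_mx subrr !scale_row_mx IH.
by rewrite scaler0 scaler0.
Qed.

Lemma cd_conjN (R : realType) (r : nat) (x : cd R r) :
  cd_conj (- x) = - cd_conj x.
Proof.
elim: r x => [//|r IH] x /=.
by rewrite opp_row_mx !linearN /= IH.
Qed.

Lemma cd_mulN (R : realType) (r : nat) (x y : cd R r) :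
  cd_mul (- x) y = - cd_mul x y /\ cd_mul x (- y) = - cd_mul x y.
Proof.
elim: r x y => [|r IH] x y /=.
  by split; apply/rowP => i; rewrite !mxE (mulNr, mulrN).
have Nl (u v : cd R r) : cd_mul (- u) v = - cd_mul u v by case: (IH u v).
have Nr (u v : cd R r) : cd_mul u (- v) = - cd_mul u v by case: (IH u v).
by split; rewrite !opp_row_mx !linearN /= !(cd_conjN, Nl, Nr) !linearN /=
  ?opprD ?opprK.
Qed.

Lemma cd_mul_conj (R : realType) (r : nat) (z : cd R r) :
  exists2 s : R, 0 <= s &
    cd_mul z (cd_conj z) = s *: cd_one R /\
    cd_mul (cd_conj z) z = s *: cd_one R.
Proof.
elim: r z => [|r IH] z /=.
  exists (z 0 0 ^+ 2); first exact: sqr_ge0.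
  by split; apply/rowP => i; rewrite !mxE (ord1 i) mulr1 expr2.
have [s s0 [s1 s2]] := IH (lsubmx z).
have [t t0 [t1 t2]] := IH (rsubmx z).
exists (s + t); first exact: addr_ge0.
have Nl (u v : cd R r) : cd_mul (- u) v = - cd_mul u v by case: (cd_mulN u v).
have Nr (u v : cd R r) : cd_mul u (- v) = - cd_mul u v by case: (cd_mulN u v).
rewrite !row_mxKl !row_mxKr cd_conjK cd_conjN !Nl !Nr s1 s2 t2 !opprK.
by rewrite addNr subrr -scalerDl scale_row_mx scaler0.
Qed.

Lemma cd_reZ1 (R : realType) (r : nat) (s : R) :
  cd_re (s *: cd_one R : cd R r) = s.
Proof.
elim: r => [|r IH] /=; first by rewrite !mxE mulr1.
by rewrite linearZ /= row_mxKl.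
Qed.

Lemma cd_absE (R : realType) (r : nat) (z : cd R r) :
  cd_mul z (cd_conj z) = (cd_abs z) ^+ 2 *: cd_one R.
Proof.
have [s s0 [sE _]] := cd_mul_conj z.
by rewrite /cd_abs sE cd_reZ1 sqr_sqrtr.
Qed.

(* Bracketed words in z, z~ and constants *)
Inductive cd_word (R : realType) (r : nat) : Type :=
| WVar
| WConj
| WConst of cd R r
| WMul of cd_word R r & cd_word R r.

Arguments WVar {R r}.
Arguments WConj {R r}.

(* A phrase is the formal infinite sum of its terms, each of which is a finite
   sum of words (for instance, the part of a given degree); finite sums of words
   are the phrases whose terms are eventually [::]. *)
Definition cd_phrase (R : realType) (r : nat) : Type := nat -> seq (cd_word R r).

Section Phrases.
Variables (R : realType) (r : nat).
Implicit Types (w : cd_word R r) (nu : cd_phrase R r) (z xi h : cd R r).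

Fixpoint word_eval w z : cd R r :=
  match w with
  | WVar => z
  | WConj => cd_conj z
  | WConst c => c
  | WMul u v => cd_mul (word_eval u z) (word_eval v z)
  end.

(* (dw/dz).h and (dw/dz~).h at z = xi.  These are operations on words, not on
   the functions the words represent: z and z~ are independent letters, with
   (dz/dz).h = h, (dz~/dz).h = 0, (dz/dz~).h = 0, (dz~/dz~).h = h~. *)
Fixpoint word_dz w xi h : cd R r :=
  match w with
  | WVar => h
  | WConj | WConst _ => 0
  | WMul u v => cd_mul (word_dz u xi h) (word_eval v xi)
              + cd_mul (word_eval u xi) (word_dz v xi h)
  end.

Fixpoint word_dzbar w xi h : cd R r :=
  match w with
  | WConj => cd_conj h
  | WVar | WConst _ => 0
  | WMul u v => cd_mul (word_dzbar u xi h) (word_eval v xi)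
              + cd_mul (word_eval u xi) (word_dzbar v xi h)
  end.

Definition phrase_series nu z : (cd R r)^nat :=
  series (fun n => \sum_(w <- nu n) word_eval w z).

Definition phrase_dz_series nu xi h : (cd R r)^nat :=
  series (fun n => \sum_(w <- nu n) word_dz w xi h).

Definition phrase_dzbar_series nu xi h : (cd R r)^nat :=
  series (fun n => \sum_(w <- nu n) word_dzbar w xi h).

(* The operators h |-> (df/dz).h and h |-> (df/dz~).h at z = xi, for the
   function f represented by nu *)
Definition phrase_dz nu xi : cd R r -> cd R r :=
  fun h => limn (phrase_dz_series nu xi h).

Definition phrase_dzbar nu xi : cd R r -> cd R r :=
  fun h => limn (phrase_dzbar_series nu xi h).

Definition superdifferentiable nu (f : cd R r -> cd R r) xi : Prop :=
  [/\ \forall z \near xi, phrase_series nu z @ \oo --> f z,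
      forall h, cvgn (phrase_dz_series nu xi h),
      forall h, cvgn (phrase_dzbar_series nu xi h) &
      is_diff xi f (phrase_dz nu xi \+ phrase_dzbar nu xi)].

End Phrases.

Definition nonproper_rotation (R : realType) (n : nat) (Q : 'M[R]_n) : Prop :=
  Q *m Q^T = 1%:M /\ \det Q = -1.

(* The last clause excludes the operators f' that are a nonproper rotation of
   the underlying real space followed by a dilation. *)
Definition pseudoconformal_at (R : realType) (r : nat) (nu : cd_phrase R r)
    (f : cd R r -> cd R r) (xi : cd R r) : Prop :=
  let f' := phrase_dz nu xi in
  [/\ superdifferentiable nu f xi,
      phrase_dzbar nu xi = cst 0,
      forall h1 h2 : cd R r,
        cd_re (cd_mul (f' h1) (cd_conj (f' h2))) * (cd_abs h1 * cd_abs h2) =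
        cd_abs (f' h1) * cd_abs (f' h2) * cd_re (cd_mul h1 (cd_conj h2)),
      f' <> cst 0 &
      forall (c : R) (Q : 'M[R]_(cd_dim r)),
        0 < c -> nonproper_rotation Q -> lin1_mx f' <> c *: Q].

(* nu xi is the phrase that represents f in a neighbourhood of xi: as for power
   series, one expansion need not converge on all of U.  A function represented
   by a single phrase on U is the case of a constant nu. *)
Definition pseudoconformal_on (R : realType) (r : nat) (U : set (cd R r))
    (nu : cd R r -> cd_phrase R r) (f : cd R r -> cd R r) : Prop :=
  forall xi, U xi -> pseudoconformal_at (nu xi) f xi.

Definition domain (R : realType) (r : nat) (A : set (cd R r)) : Prop :=
  open A /\ connected A.

(* Main.v *)
Require Import Defs.
From HB Require Import structures.
From mathcomp Require Import all_boot all_order all_algebra.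
From mathcomp Require Import all_classical all_reals all_analysis.
From mathcomp Require Import lra.

(** The image is connected because f is continuous.  For openness, f is only
    known to be differentiable at each point of U, with a derivative that may be
    discontinuous, so the inverse function theorem does not apply.  It is
    replaced by a minimisation that uses the derivative only pointwise.

    Let x be a point of U.  As f'(x) is injective, x is isolated in the fibre of
    f over f(x) (injective_diff_isolated).  Hence, on a small sphere around x,
    the distance to f(x) of the values of f is bounded below by some d > 0.  Let
    y be within d / 2 of f(x), and let c minimise |y - f(c)| over the closed
    ball.  The points of the sphere do worse than x, so c is interior.  As f'(c)
    is injective on a finite-dimensional space, it is also surjective, so that
    if f(c) differed from y one could move c in the direction h with
    f'(c).h = y - f(c) and come closer to y (surjective_diff_min_dist).
    Therefore y = f(c), and the image contains a ball around f(x)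
    (open_image_injective_diff).

    It remains to see that the derivative is injective.  By cd_re_mul_conj, the
    product Re(x y~) is the Euclidean scalar product, so that the conformality
    condition says that f' preserves the angles between vectors outside its
    kernel.  A linear map that does so and is not zero is injective
    (conformal_injective): if f' k = 0 while f' h <> 0, then all the vectors
    h + t k have the same image as h, so each of them has angle zero with h,
    which forces k = 0. *)

Set Implicit Arguments.
Unset Strict Implicit.
Unset Printing Implicit Defensive.

Import Order.TTheory GRing.Theory Num.Theory Num.Def.
Import numFieldNormedType.Exports.

Local Open Scope classical_set_scope.
Local Open Scope ring_scope.

(** * Compactness of balls and spheres *)

Lemma compact_pos_lower_bound (R : realType) (T : topologicalType)
    (A : set T) (g : T -> R) :
  compact A -> {within A, continuous g} -> (forall t, A t -> 0 < g t) ->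
  exists2 d, 0 < d & forall t, A t -> d <= g t.
Proof.
move=> cA cg gpos; have [A0|/set0P/negP/negPn/eqP A0] := pselect (A !=set0).
  have [c + cmin] := compact_EVT_min A0 cA cg.
  rewrite inE => Ac; exists (g c); first exact: gpos.
  by move=> t At; apply: cmin; rewrite inE.
by exists 1 => // t; rewrite A0.
Qed.

Lemma distr_continuous (R : realType) (V : normedModType R) (a : V) :
  continuous (fun z => `|a - z|).
Proof. by move=> z; exact: (cvg_norm (cvgB (cvg_cst a) cvg_id)). Qed.

Lemma sphere_closed (R : realType) (V : normedModType R) (x : V) (e : R) :
  closed [set z | `|x - z| = e].
Proof.
apply: (@preimage_closed _ _ (fun z => `|x - z|) [set e]); last exact: closed_eq.
by move=> z _; exact: distr_continuous.
Qed.

Lemma closed_ball_rV_compact (R : realType) n (x : 'rV[R]_n) (e : R) :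
  compact (closed_ball_ normr x e).
Proof.
apply: bounded_closed_compact; last exact: closed_closed_ball_.
exists (`|x| + e); split; first exact: num_real.
move=> M /ltW leM z /= ze; apply: le_trans leM.
by rewrite -[z](subKr x) (le_trans (ler_normB _ _))// lerD2l.
Qed.

Lemma sphere_rV_compact (R : realType) n (x : 'rV[R]_n) (e : R) :
  compact [set z | `|x - z| = e].
Proof.
apply: (@subclosed_compact _ _ (closed_ball_ normr x e)).
- exact: sphere_closed.
- exact: closed_ball_rV_compact.
- by move=> z; rewrite /closed_ball_ /= => ->.
Qed.

(** * Open mapping theorem for differentiable maps *)

Lemma differentiable_remainder (R : realType) (V W : normedModType R)
    (f : V -> W) (x : V) (e : R) : differentiable f x -> 0 < e ->
  \forall h \near (0 : V), `|f (x + h) - (f x + 'd f x h)| <= e * `|h|.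
Proof.
move=> /diff_locally /eqaddoP df e0; have := df e e0.
by apply: filterS => h; rewrite [x + h]addrC.
Qed.

(** In finite dimension an injective linear map is bounded below,
    |'d f x h| >= m |h| with m > 0; near x the remainder is at most
    (m / 2) |h|, too small to cancel the linear part. *)
Lemma injective_diff_isolated (R : realType) n (W : normedModType R)
    (f : 'rV[R]_n -> W) (x : 'rV[R]_n) : differentiable f x ->
  (forall h, 'd f x h = 0 -> h = 0) ->
  \forall z \near x, f z = f x -> z = x.
Proof.
move=> df inj.
have cL : continuous ('d f x) by apply: diff_continuous.
have [m m0 mP] : exists2 m, 0 < m & forall h, `|0 - h| = 1 -> m <= `|'d f x h|.
  apply: compact_pos_lower_bound; first exact: sphere_rV_compact.
    by apply: continuous_subspaceT => h; exact: (cvg_norm (cL h)).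
  move=> h /=; rewrite sub0r normrN normr_gt0.
  apply: contra_eq_neq.
  by move=> /inj ->; rewrite normr0 eq_sym oner_neq0.
have mL h : m * `|h| <= `|'d f x h|.
  have [->|h0] := eqVneq h 0; first by rewrite normr0 mulr0.
  have nh : 0 < `|h| by rewrite normr_gt0.
  rewrite -ler_pdivlMr//.
  have := mP (`|h|^-1 *: h); rewrite sub0r normrN normrZ normfV normr_id.
  rewrite mulVf ?gt_eqF// => /(_ erefl).
  by rewrite linearZ normrZ normfV normr_id mulrC.
have m20 : 0 < m / 2 by rewrite divr_gt0.
apply/nbhs0P; have := differentiable_remainder df m20.
apply: filterS => h + fxh; rewrite fxh opprD addrA subrr sub0r normrN => hL.
apply/eqP; rewrite -subr_eq0 addrAC subrr add0r -normr_eq0.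
by have := le_trans (mL h) hL; have := normr_ge0 h; clear -m0; nra.
Qed.

(** Fermat's rule, in a form valid for any norm, smooth or not: if
    f z <> y, the point z + t h with small t > 0 has distance at most
    (1 - t) |f z - y| + o(t) to y, less than |f z - y|. *)
Lemma surjective_diff_min_dist (R : realType) (V W : normedModType R)
    (f : V -> W) (z h : V) (y : W) : differentiable f z ->
  'd f z h = y - f z ->
  (\forall w \near z, `|f z - y| <= `|f w - y|) -> f z = y.
Proof.
move=> df dfh zmin; apply/eqP; rewrite -subr_eq0; apply/negPn/negP.
rewrite -normr_gt0 => w0.
have h1 : 0 < `|h| + 1 by rewrite ltr_wpDl.
(* chosen so that the remainder e t |h| stays below the gain t |f z - y|;
   the summand 1 keeps the denominator positive when h = 0 *)
pose e := `|f z - y| / (2 * (`|h| + 1)).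
have e0 : 0 < e by rewrite divr_gt0// mulr_gt0.
have eh : e * `|h| < `|f z - y|.
  rewrite /e mulrAC ltr_pdivrMr ?mulr_gt0//.
  by have := normr_ge0 h; clear -w0 h1; nra.
have th0 (P : set V) : (\forall k \near 0, P k) ->
    \forall t \near (0:R)^'+, P (t *: h).
  by move=> /(near0Z h); exact: cvg_within.
suff : \forall t \near (0:R)^'+, False by move=> /filter_ex[].
near=> t.
have t0 : 0 < t by near: t; exact: nbhs_right_gt.
have t1 : t < 1 by near: t; exact: nbhs_right_lt.
have : `|f z - y| <= `|f (z + t *: h) - y|.
  near: t; have /nbhs0P := zmin; exact: th0.
have : `|f (z + t *: h) - (f z + 'd f z (t *: h))| <= e * `|t *: h|.
  by near: t; have := differentiable_remainder df e0; exact: th0.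
rewrite linearZ dfh normrZ gtr0_norm// => le2 le1.
have : `|f (z + t *: h) - y| <= e * (t * `|h|) + (1 - t) * `|f z - y|.
  have -> : f (z + t *: h) - y =
      (f (z + t *: h) - (f z + t *: (y - f z))) + (1 - t) *: (f z - y).
    rewrite -[y - f z]opprB scalerN opprD opprK addrA scalerBl scale1r.
    by rewrite addrACA subrr addr0 addrA subrK.
  rewrite (le_trans (ler_normD _ _))// lerD// normrZ ger0_norm// subr_ge0.
  exact: ltW.
move=> le3; have := le_trans le1 le3; clear -t0 eh; nra.
Unshelve. all: by end_near.
Qed.

(** A point y near f x is reached by minimising the distance from y to the
    values of f over a small closed ball around x.  Isolation of x in its fibre
    keeps the minimiser off the sphere; injectivity at the minimiser means
    surjectivity, by equality of dimensions, and makes the minimum zero. *)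
Lemma open_image_injective_diff (R : realType) n (f : 'rV[R]_n -> 'rV[R]_n)
    (U : set 'rV[R]_n) : open U ->
  (forall x, U x -> differentiable f x) ->
  (forall x, U x -> forall h, 'd f x h = 0 -> h = 0) ->
  open (f @` U).
Proof.
move=> oU df inj; rewrite openE => _ [x Ux <-].
have : \forall z \near x, U z /\ (f z = f x -> z = x).
  apply: filterI; first exact: open_nbhs_nbhs.
  exact: injective_diff_isolated (df x Ux) (inj x Ux).
move=> /nbhs_closedballP[p]; have : 0 < p%:num by [].
move: (p%:num) => e e0; rewrite closed_ballE// => Be.
have fcont (A : set 'rV[R]_n) (y : 'rV[R]_n) : A `<=` closed_ball_ normr x e ->
    {within A, continuous (fun z => `|y - f z|)}.
  move=> AB; apply: continuous_in_subspaceT => z; rewrite inE => /AB/Be[Uz _].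
  apply: (@continuous_comp _ _ _ f (fun w => `|y - w|)).
    exact: differentiable_continuous (df z Uz).
  exact: distr_continuous.
have [d d0 dP] : exists2 d, 0 < d & forall z, `|x - z| = e -> d <= `|f x - f z|.
  apply: (@compact_pos_lower_bound _ _ [set z | `|x - z| = e]).
  - exact: sphere_rV_compact.
  - by apply: fcont => z; rewrite /closed_ball_ /= => ->.
  - move=> z /= ze; rewrite normr_gt0 subr_eq0; apply/eqP => fxz.
    have [|_ /(_ (esym fxz)) zx] := Be z; first by rewrite /closed_ball_ /= ze.
    by move: e0; rewrite -ze zx subrr normr0 ltxx.
apply/nbhs_ballP; exists (d / 2); first by rewrite /= divr_gt0.
move=> y; rewrite -ball_normE /ball_ /= => xy.
have Bx : closed_ball_ normr x e x.
  by rewrite /closed_ball_ /= subrr normr0 ltW.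
have B0 : closed_ball_ normr x e !=set0 by exists x.
have [c] := compact_EVT_min B0 (@closed_ball_rV_compact _ _ x e)
  (fcont _ y (@subset_refl _ _)).
rewrite inE /closed_ball_ /= => xc cmin.
have [Uc _] := Be c xc; exists c => //.
have yc : `|y - f c| < d / 2.
  apply: le_lt_trans xy; rewrite (distrC (f x)); apply: cmin.
  by rewrite inE.
(* at distance e from x, the value f c would be at least d / 2 away from y *)
have {}xc : `|x - c| < e.
  rewrite lt_neqAle xc andbT; apply/eqP => /dP.
  have := ler_distD y (f x) (f c).
  by clear -xy yc; lra.
have [h hE] : exists h, 'd f c h = y - f c.
  pose M := lin1_mx ('d f c).
  have Mu : M \in unitmx.
    rewrite -row_free_unit -kermx_eq0; apply/eqP/row_matrixP => i.
    rewrite row0; apply: (inj c Uc); rewrite -mul_rV_lin1.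
    by apply/sub_kermxP; exact: row_sub.
  by exists ((y - f c) *m invmx M); rewrite -mul_rV_lin1 mulmxKV.
apply: (surjective_diff_min_dist (df c Uc) hE).
have : nbhs c (ball x e).
  by apply: open_nbhs_nbhs; split; [exact: ball_open|rewrite -ball_normE].
apply: filterS => z; rewrite -ball_normE /= => xz.
by rewrite ![`|f _ - y|]distrC; apply: cmin; rewrite inE /=; exact: ltW.
Qed.

(** * Conformal linear maps *)

Definition dotr (R : realType) n (x y : 'rV[R]_n) : R := (x *m y^T) 0 0.

(** The Euclidean norm; `|x| is the sup norm, which does not come from a scalar
    product. *)
Definition enorm (R : realType) n (x : 'rV[R]_n) : R := Num.sqrt (dotr x x).

Lemma dotrC (R : realType) n (x y : 'rV[R]_n) : dotr x y = dotr y x.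
Proof. by rewrite /dotr -[x *m _]trmxK trmx_mul trmxK mxE. Qed.

Lemma dotrDr (R : realType) n (x y z : 'rV[R]_n) :
  dotr x (y + z) = dotr x y + dotr x z.
Proof. by rewrite /dotr linearD mulmxDr mxE. Qed.

Lemma dotrZr (R : realType) n (x y : 'rV[R]_n) a :
  dotr x (a *: y) = a * dotr x y.
Proof. by rewrite /dotr linearZ -scalemxAr mxE. Qed.

Lemma dotrE (R : realType) n (x : 'rV[R]_n) :
  dotr x x = \sum_i x 0 i ^+ 2.
Proof. by rewrite /dotr mxE; apply: eq_bigr => i _; rewrite mxE expr2. Qed.

Lemma dotr_ge0 (R : realType) n (x : 'rV[R]_n) : 0 <= dotr x x.
Proof. by rewrite dotrE sumr_ge0// => i _; exact: sqr_ge0. Qed.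

Lemma dotr_eq0 (R : realType) n (x : 'rV[R]_n) : dotr x x = 0 -> x = 0.
Proof.
rewrite dotrE => /eqP; rewrite psumr_eq0 => [|i _]; last exact: sqr_ge0.
move=> /allP x0; apply/rowP => i; rewrite mxE; apply/eqP.
by rewrite -sqrf_eq0; apply: x0; rewrite mem_index_enum.
Qed.

(** For k in the kernel and h outside it, conformality of h and h + t k reads
    |h| |h + t k| = <h, h> + t <h, k>.  Nonnegativity of the right-hand side for
    all t gives <h, k> = 0, and then t = 1 gives |h + k| = |h|, so that k = 0 by
    Pythagoras. *)
Lemma conformal_injective (R : realType) m n
    (L : {linear 'rV[R]_m -> 'rV[R]_n}) :
  (forall h1 h2, dotr (L h1) (L h2) * (enorm h1 * enorm h2) =
                 enorm (L h1) * enorm (L h2) * dotr h1 h2) ->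
  (exists h, L h != 0) -> forall k, L k = 0 -> k = 0.
Proof.
move=> conf [h Lh0] k Lk0.
have cs t : enorm h * enorm (h + t *: k) = dotr h h + t * dotr h k.
  have LE : L (h + t *: k) = L h.
    by rewrite linearD linearZ /= Lk0 scaler0 addr0.
  have := conf h (h + t *: k).
  rewrite LE -expr2 sqr_sqrtr ?dotr_ge0// dotrDr dotrZr => /mulfI; apply.
  by apply: contra_neq Lh0; exact: dotr_eq0.
have hk0 : dotr h k = 0.
  apply/eqP/negPn/negP => b0.
  (* this t makes the right-hand side of cs equal to -1 *)
  have : 0 <= dotr h h + (- (dotr h h + 1) / dotr h k) * dotr h k.
    by rewrite -cs mulr_ge0// sqrtr_ge0.
  by rewrite divfK// opprD addNKr oppr_ge0 ler10.
have h0 : dotr h h != 0.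
  by apply: contra_neq Lh0 => /dotr_eq0 ->; rewrite linear0.
have := cs 1; rewrite hk0 mulr0 addr0 scale1r => /(congr1 (fun u => u ^+ 2)).
rewrite exprMn !sqr_sqrtr ?dotr_ge0// expr2 => /(mulfI h0).
rewrite dotrDr ![dotr (h + k) _]dotrC !dotrDr [dotr k h]dotrC hk0 addr0 add0r.
by rewrite -[RHS]addr0 => /addrI; exact: dotr_eq0.
Qed.

(** * Cayley-Dickson numbers *)

(** The two formulas are proved together: with x = (a, b) and y = (c, d), the
    first component of x y~ is a c~ + d~ b, so the induction for the first
    formula needs the second one for d and b. *)
Lemma cd_re_mul_conj (R : realType) r (x y : cd R r) :
  cd_re (cd_mul x (cd_conj y)) = dotr x y /\
  cd_re (cd_mul (cd_conj x) y) = dotr x y.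
Proof.
elim: r x y => [|r IH] x y /=.
  by rewrite /dotr !mxE big_ord_recl big_ord0 !mxE addr0 !ord1.
have reD (u v : cd R r) : cd_re (u + v) = cd_re u + cd_re v.
  by elim: r {IH x y} u v => [|r IH] u v /=; rewrite ?mxE// linearD IH.
have -> : dotr x y = dotr (lsubmx x) (lsubmx y) + dotr (rsubmx x) (rsubmx y).
  by rewrite /dotr -{1}(hsubmxK x) -{1}(hsubmxK y) tr_row_mx mul_row_col mxE.
have [lE1 lE2] := IH (lsubmx x) (lsubmx y).
have [_ rE] := IH (rsubmx y) (rsubmx x).
rewrite !row_mxKl !row_mxKr cd_conjN.
rewrite (cd_mulN (cd_conj (rsubmx y)) _).1 (cd_mulN _ (rsubmx x)).2 !opprK.
by rewrite !reD lE1 lE2 rE [dotr (rsubmx y) _]dotrC.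
Qed.

Lemma cd_abs_enorm (R : realType) r (z : cd R r) : cd_abs z = enorm z.
Proof. by rewrite /cd_abs (cd_re_mul_conj z z).1. Qed.

Theorem theorem30 (R : realType) (r : nat) (hr : r = 2%N \/ r = 3%N)
  (U : set (cd R r)) (nu : cd R r -> cd_phrase R r) (f : cd R r -> cd R r)
  (hU : domain U) (hf : pseudoconformal_on U nu f) :
  domain (f @` U).
Proof.
have [oU cU] := hU.
have df x : U x -> differentiable f x.
  by move=> /hf[[_ _ _ fd] _ _ _ _]; exact: ex_diff.
split.
  apply: open_image_injective_diff => // x Ux.
  have [[_ _ _ fd] dzbar0 conf dz0 _] := hf x Ux.
  have dfE : 'd f x = phrase_dz (nu x) x :> (_ -> _).
    by rewrite diff_val dzbar0; apply/funext => h /=; rewrite addr0.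
  apply: conformal_injective.
  - move=> h1 h2; rewrite dfE -!cd_abs_enorm -!(cd_re_mul_conj _ _).1.
    exact: conf.
  - apply/not_existsP => z0; apply: dz0.
    by rewrite -dfE; apply/funext => h; apply/eqP/negPn/negP/z0.
apply: connected_continuous_connected => //.
apply: continuous_in_subspaceT => x; rewrite inE => /df.
exact: differentiable_continuous.
Qed.
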